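(* Let $k$ be an algebraically closed field, let $R$ be an integral $k$-algebra (that is, a commutative $k$-algebra that is an integral domain), and let $f_1, \ldots, f_r \in R$ be non-zero elements such that $f_i/f_j \notin k$ for all $i \neq j$. Then there exists an integer $e$ with $1 \le e \le r!$ such that $f_1^e, \ldots, f_r^e$ are linearly independent over $k$.
   Context: The field $k$ has arbitrary characteristic. The quotient $f_i/f_j$ is taken in the fraction field of $R$, and $k$ is regarded as a subfield of that fraction field; thus the condition $f_i/f_j \notin k$ says that $f_i$ is not a $k$-scalar multiple of $f_j$. *)

(* Defs.v *)
From HB Require Import structures.
From mathcomp Require Import all_boot all_order all_algebra.

Set Implicit Arguments.
Unset Strict Implicit.
Unset Printing Implicit Defensive.

Import GRing.Theory.
Local Open Scope ring_scope.

#[short(type="integralAlgType")]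
HB.structure Definition IntegralAlgebra (k : fieldType) :=
  {R of GRing.Algebra k R & GRing.IntegralDomain R}.

Section IntegralAlgebraDefs.
Context {k : fieldType} {R : integralAlgType k}.

(* k is identified with its image under c |-> c *: 1 in the fraction field
   of R. *)
Definition in_base_field (x : {fraction R}) : Prop :=
  exists c : k, x = FracField.tofrac c%:A.

(* The library's [free] needs a finite-dimensional ambient space, which R
   need not be. *)
Definition lin_indep (n : nat) (v : 'I_n -> R) : Prop :=
  forall c : 'I_n -> k, \sum_(i < n) c i *: v i = 0 -> forall i, c i = 0.

End IntegralAlgebraDefs.

(* Main.v *)
Require Import Defs.
From mathcomp Require Import all_boot all_order all_algebra.
From mathcomp Require Import perm.
From mathcomp Require Import boolp classical_sets.
Local Open Scope ring_scope.
Set Implicit Arguments.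
Unset Strict Implicit.
Unset Printing Implicit Defensive.
Import GRing.Theory.

(** Let K be the fraction field of R, and for a permutation s of the indices
    let M_s = f_{s 1} (x) ... (x) f_{s r}, an element of the r-fold tensor
    power T of K over k.  If f_1^e, ..., f_r^e are dependent, their
    antisymmetrised tensor vanishes: sum_s sgn(s) M_s^e = 0 in T.  Suppose that
    this happens for all e from 1 to r!, and combine these equations linearly
    with the coefficients, taken in T, of the polynomial
    P(X) = X prod_{t <> 1} (X - M_t), which has degree r! and no constant
    term.  As P(M_s) = 0 for s <> 1, what remains is
    P(M_1) = M_1 prod_{t <> 1} (M_1 - M_t) = 0.  This is absurd, because no
    M_1 - M_t with t <> 1 is a zero divisor of T.

    The last fact is where the condition on the ratios enters.  Choose j with
    t j <> j.  If (M_1 - M_t) Z = 0, then multiplication of the j-th factor by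
    u = f_j / f_{t j} has the same effect on Z as multiplication of the other
    factors by f_{t i} / f_i.  So u maps the span of the j-th components
    of Z to itself.  That span has finite dimension over k, so if Z <> 0 then u
    is algebraic over k, and u lies in k because k is algebraically closed
    ([closed_finite_orbit], [tensor_shift_cancel]).

    An element sum_a c_a x_{a1} (x) ... (x) x_{ar} of T is represented by the
    function phi |-> sum_a c_a prod_i phi_i(x_{ai}) of r linear functionals on
    K; multiplication by a pure tensor g becomes the substitution of
    x |-> phi_i (g_i x) for phi_i.  The representation is faithful because
    linear functionals separate the points of K ([klinear_separates]). *)

(** * Linear functionals on a field extension *)

Section Functionals.
Context {k K : fieldType} (iota : {rmorphism k -> K}).

Definition klinear (phi : K -> k) : Prop :=
  forall c x y, phi (iota c * x + y) = c * phi x + phi y.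

Lemma klinear0 phi : klinear phi -> phi 0 = 0.
Proof.
by move=> lin; have := lin (-1) 0 0; rewrite mulr0 addr0 mulN1r addNr.
Qed.

Lemma klinear_sum phi m (c : 'I_m -> k) (x : 'I_m -> K) : klinear phi ->
  phi (\sum_i iota (c i) * x i) = \sum_i c i * phi (x i).
Proof.
move=> lin; elim/big_rec2: _ => [|i y w _ <-]; first exact: klinear0.
exact: lin.
Qed.

Lemma klinear_mul phi a : klinear phi -> klinear (fun x => phi (a * x)).
Proof. by move=> lin c x y; rewrite mulrDr mulrCA lin. Qed.

(** A subset W of K closed under linear combinations and maximal among those
    that avoid z is a hyperplane complementary to the line k z; the functional
    is the coordinate along z. *)
Lemma klinear_separates z : z != 0 -> exists phi, klinear phi /\ phi z <> 0.
Proof.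
move=> z0.
pose P (W : set K) := ~ W z /\
  forall c x y, W x -> W y -> W (iota c * x + y).
have [|W [[Wz Wlin] Wmax]] := @Zorn_bigcup K P.
  move=> F FP Ftot; split=> [[X FX]|c x y [X FX Xx] [Y FY Yy]].
    exact: (FP _ FX).1.
  have [XY|YX] := Ftot X Y FX FY.
    by exists Y => //; apply: (FP _ FY).2 => //; apply: XY.
  by exists X => //; apply: (FP _ FX).2 => //; apply: YX.
(* Closure under combinations holds for the empty set too, so 0 \in W comes from
   maximality. *)
have W0 : W 0.
  apply: contrapT => nW0; apply: (Wmax [set 0 : K]%classic).
    split=> [x Wx|]; last by move/(_ 0 erefl).
    case: nW0; have := Wlin (-1) x x Wx Wx.
    by rewrite rmorphN1 mulN1r addNr.
  split=> [/eqP|c x y -> ->]; first by rewrite (negPf z0).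
  by rewrite mulr0 addr0.
have WZ c x : W x -> W (iota c * x).
  by move=> Wx; have := Wlin c x 0 Wx W0; rewrite addr0.
have cover v : exists c, W (v - iota c * z).
  case: (pselect (W v)) => Wv; first by exists 0; rewrite rmorph0 mul0r subr0.
  apply: contrapT => nc.
  pose V := [set y | exists c w, W w /\ y = w + iota c * v]%classic.
  apply: (Wmax V).
    split=> [w Ww|VW].
      by exists 0, w; rewrite rmorph0 mul0r addr0.
    by apply/Wv/VW; exists 1, 0; rewrite rmorph1 mul1r add0r.
  split=> [[c [w [Ww zE]]]|c x y [d [w [Ww ->]]] [d' [w' [Ww' ->]]]].
    have [c0|c0] := eqVneq c 0.
      by apply: Wz; rewrite zE c0 rmorph0 mul0r addr0.
    apply: nc; exists c^-1.
    suff -> : v - iota c^-1 * z = iota (- c^-1) * w by exact: WZ.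
    rewrite zE mulrDr mulrA -rmorphM mulVf // rmorph1 mul1r rmorphN mulNr.
    by rewrite opprD addrCA subrr addr0.
  exists (c * d + d'), (iota c * w + w'); split; first exact: Wlin.
  by rewrite rmorphD rmorphM mulrDr !mulrDl -!mulrA addrACA.
have [phi phiP] := choice cover.
have uniq c d v : W (v - iota c * z) -> W (v - iota d * z) -> c = d.
  move=> Wc Wd; apply: contrapT => /eqP; rewrite -subr_eq0 => cd.
  apply: Wz; have -> : z = iota (c - d)^-1 *
      (iota (-1) * (v - iota c * z) + (v - iota d * z)).
    rewrite rmorphN1 mulN1r opprB addrA subrK -mulrBl.
    by rewrite -rmorphB mulrA -rmorphM mulVf // rmorph1 mul1r.
  by apply: WZ; apply: Wlin.
exists phi; split=> [c x y|].
  apply: (uniq _ _ (iota c * x + y)) => //.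
  rewrite rmorphD rmorphM mulrDl opprD addrACA -mulrA -mulrBr.
  exact: Wlin.
rewrite (_ : phi z = 1); first by apply/eqP; exact: oner_neq0.
by apply: (uniq _ _ z) => //; rewrite rmorph1 mul1r subrr.
Qed.

End Functionals.

(** * Finite-dimensional orbits over an algebraically closed field *)

(** The m + 1 vectors z, u z, ..., u^m z in the span of m elements satisfy a
    linear relation, that is, q(u) z = 0 for some nonzero polynomial q over k;
    as z is nonzero and q splits over k, u is one of its roots in k. *)
Lemma closed_finite_orbit (k : closedFieldType) (K : fieldType)
    (iota : {rmorphism k -> K}) (u z : K) m (x : 'I_m -> K)
    (A : nat -> 'I_m -> k) :
  z != 0 -> (forall n, u ^+ n * z = \sum_i iota (A n i) * x i) ->
  exists c, u = iota c.
Proof.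
move=> z0 orb.
pose M := \matrix_(n < m.+1, i < m) A n i.
have /rowV0Pn [v /sub_kermxP vM v0] : kermx M != 0.
  rewrite kermx_eq0 /row_free neq_ltn ltnS; apply/orP; left.
  exact: rank_leq_col.
pose q := rVpoly v.
have q0 : q != 0.
  by apply: contraNneq v0 => qE; rewrite -(rVpolyK v) -/q qE raddf0.
have qu0 : (map_poly iota q).[u] = 0.
  apply/eqP; rewrite -(mulIr_eq0 _ (mulIf z0)); apply/eqP.
  rewrite (@horner_coef_wide _ m.+1) ?size_map_poly ?size_poly //.
  transitivity (\sum_i iota ((v *m M) 0 i) * x i); last first.
    by rewrite vM big1 // => i _; rewrite mxE rmorph0 mul0r.
  rewrite mulr_suml; under [RHS]eq_bigr do rewrite mxE rmorph_sum mulr_suml.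
  rewrite exchange_big; apply: eq_bigr => n _ /=.
  rewrite coef_map coef_rVpoly_ord -mulrA orb mulr_sumr.
  by apply: eq_bigr => i _; rewrite mxE rmorphM mulrA.
have [s qE] := closed_field_poly_normal q.
move: qu0; rewrite qE map_polyZ hornerZ rmorph_prod horner_prod => /eqP.
rewrite mulf_eq0 fmorph_eq0 lead_coef_eq0 (negPf q0) /= prodf_seq_eq0.
case/hasP=> c _; rewrite /= rmorphB /= map_polyX map_polyC /= hornerXsubC.
by rewrite subr_eq0 => /eqP; exists c.
Qed.

(** * Cancellation in the tensor power *)

Section TensorPower.
Context {k : closedFieldType} {K : fieldType} (iota : {rmorphism k -> K}).
Context {r : nat}.
Implicit Types (phi : 'I_r -> K -> k) (g h : 'I_r -> K).

(** The transpose of multiplication by the pure tensor g. *)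
Definition shift g phi : 'I_r -> K -> k := fun i x => phi i (g i * x).

Definition klinears phi := forall i, klinear iota (phi i).

Lemma klinears_shift g phi : klinears phi -> klinears (shift g phi).
Proof. by move=> lin i; exact: klinear_mul. Qed.

(** The functions of r functionals that come from the r-fold tensor power
    of K over k. *)
Definition tensor (Z : ('I_r -> K -> k) -> k) : Prop :=
  exists s : seq (k * ('I_r -> K)),
    forall phi, Z phi = \sum_(p <- s) p.1 * \prod_i phi i (p.2 i).

Definition slot phi (j : 'I_r) (psi : K -> k) : 'I_r -> K -> k :=
  fun i => if i == j then psi else phi i.

(** Contracting a tensor with all the functionals but the j-th one leaves a
    vector of K, which lies in the span of the finitely many j-th components
    whatever the functionals are. *)
Lemma tensor_slot Z (j : 'I_r) : tensor Z ->
  exists m (x : 'I_m -> K) (A : ('I_r -> K -> k) -> 'I_m -> k),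
    (forall phi, klinears phi ->
       Z phi = phi j (\sum_i iota (A phi i) * x i)) /\
    (forall phi psi, A (slot phi j psi) = A phi).
Proof.
case=> s ZE; exists (size s), (fun i => (tnth (in_tuple s) i).2 j).
exists (fun phi i => (tnth (in_tuple s) i).1 *
  \prod_(i' | i' != j) phi i' ((tnth (in_tuple s) i).2 i')); split.
  move=> phi lin; rewrite ZE klinear_sum //.
  rewrite big_tnth; apply: eq_bigr => i _.
  by rewrite (bigD1 j) //= mulrA mulrAC.
move=> phi psi; apply: funext => i; congr (_ * _).
by apply: eq_bigr => i' /negPf ne; rewrite /slot ne.
Qed.

(** In words of tensors, the difference of the pure tensors a and b is not a
    zero divisor.  With z phi the contraction of Z away from the slot j, the
    hypothesis gives
    (a j / b j) * z phi = z (shift (b / a) phi); hence all the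
    (a j / b j) ^+ n * z phi are contractions of Z, in a finite-dimensional
    space. *)
Lemma tensor_shift_cancel Z (a b : 'I_r -> K) (j : 'I_r) :
    tensor Z -> (forall i, a i != 0) ->
    (forall c, a j / b j <> iota c) ->
    (forall phi, klinears phi -> Z (shift a phi) = Z (shift b phi)) ->
  forall phi, klinears phi -> Z phi = 0.
Proof.
move=> Zt a0 trans Zab.
have bj0 : b j != 0.
  by apply/eqP => bj; apply: (trans 0); rewrite bj invr0 mulr0 rmorph0.
have [m [x [A [ZE Aslot]]]] := tensor_slot j Zt.
pose z phi := \sum_i iota (A phi i) * x i.
have slot_lin phi psi : klinears phi -> klinear iota psi ->
    klinears (slot phi j psi).
  by move=> lin lpsi i; rewrite /slot; case: eqP.
have shift_slot g phi psi :
    shift g (slot phi j psi) = slot (shift g phi) j (fun y => psi (g j * y)).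
  by apply: funext => i; rewrite /shift /slot; case: eqP => // ->.
(* The j-th functional does not affect z, so it can be chosen to separate the
   two sides. *)
have zab phi : klinears phi -> a j * z (shift a phi) = b j * z (shift b phi).
  move=> lin; apply/eqP; rewrite -subr_eq0; apply/negP => /negP ne.
  have [psi [lpsi]] := klinear_separates iota ne; apply.
  have lin' := slot_lin _ _ lin lpsi.
  have := Zab _ lin'; rewrite !ZE; try exact: klinears_shift.
  rewrite !shift_slot !Aslot /slot eqxx -/(z _) -/(z _) => E.
  have := lpsi (-1) (b j * z (shift b phi)) (a j * z (shift a phi)).
  by rewrite rmorphN1 mulN1r addrC E mulN1r addNr.
pose w i := b i / a i.
have zstep phi : klinears phi -> a j / b j * z phi = z (shift w phi).
  move=> lin; have := zab _ (klinears_shift (fun i => (a i)^-1) lin).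
  have -> : shift a (shift (fun i => (a i)^-1) phi) = phi.
    apply: funext => i; apply: funext => y.
    by rewrite /shift mulrA mulVf // mul1r.
  have -> : shift b (shift (fun i => (a i)^-1) phi) = shift w phi.
    apply: funext => i; apply: funext => y.
    by rewrite /shift /w mulrA [_^-1 * _]mulrC.
  by move=> E; rewrite mulrAC E mulrAC divff // mul1r.
move=> phi lin; rewrite ZE // -/(z phi).
have [->|z0] := eqVneq (z phi) 0; first exact: klinear0 (lin j).
have [c uc] : exists c, a j / b j = iota c; last by move/trans: uc.
apply: (closed_finite_orbit (A := fun n => A (iter n (shift w) phi)) z0).
move=> n; rewrite -/(z _).
suff [_ ->] : klinears (iter n (shift w) phi) /\
    (a j / b j) ^+ n * z phi = z (iter n (shift w) phi) by [].
elim: n => [|n [linn IH]]; first by rewrite expr0 mul1r.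
split; first exact: klinears_shift.
by rewrite exprS -mulrA IH zstep.
Qed.

End TensorPower.

(** * The alternating sums of powers *)

Section Vandermonde.
Context {k : closedFieldType} {K : fieldType} (iota : {rmorphism k -> K}).
Context {r : nat} (F : 'I_r -> K).
Implicit Types (phi : 'I_r -> K -> k) (h : 'I_r -> K) (s t : 'S_r).

(** The tensor h * prod_(t in l) (M_s - M_t), where M_s is the pure tensor with
    components F (s i).  The multiplier h is a parameter of the recursion so
    that the product can be expanded without multiplying general tensors. *)
Fixpoint diffprod (l : seq 'S_r) s h phi : k :=
  if l is t :: l' then
    diffprod l' s (fun i => F (s i) * h i) phi
    - diffprod l' s (fun i => F (t i) * h i) phi
  else \prod_i phi i (h i).

Lemma diffprod_mem l s h phi : s \in l -> diffprod l s h phi = 0.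
Proof.
elim: l h => //= t l IH h; rewrite inE => /predU1P[->|sl]; first exact: subrr.
by rewrite !IH // subrr.
Qed.

Lemma diffprod_shift l s g h phi :
  diffprod l s (fun i => g i * h i) phi = diffprod l s h (shift g phi).
Proof.
elim: l h => //= t l IH h; rewrite -!IH.
by congr (diffprod _ _ _ _ - diffprod _ _ _ _); apply: funext => i;
   rewrite mulrCA.
Qed.

Lemma tensor_diffprod l s h : tensor (diffprod l s h).
Proof.
elim: l h => [|t l IH] h /=.
  by exists [:: (1, h)] => phi; rewrite big_seq1 mul1r.
have [u uE] := IH (fun i => F (s i) * h i).
have [v vE] := IH (fun i => F (t i) * h i).
exists (u ++ [seq (- p.1, p.2) | p <- v]) => phi.
rewrite uE vE big_cat big_map /= -sumrN; congr (_ + _).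
by apply: eq_bigr => p _; rewrite mulNr.
Qed.

(** M_1 - M_t cancels by [tensor_shift_cancel], at a slot that t moves; after
    removal of all these factors the pure tensor h is left, and it is nonzero
    because functionals separate points. *)
Lemma diffprod1_neq0 l h :
    (forall i, F i != 0) -> (forall i, h i != 0) ->
    (forall i j c, i <> j -> F i / F j <> iota c) ->
    1%g \notin l ->
  ~ forall phi, klinears iota phi -> diffprod l 1%g h phi = 0.
Proof.
move=> F0 h0 ratio; elim: l => [|t l IH] /=.
  move=> _ vanish.
  have [phi phiP] := choice (fun i => klinear_separates iota (h0 i)).
  have /eqP := vanish phi (fun i => (phiP i).1).
  by rewrite prodf_seq_eq0 => /hasP[i _ /eqP]; exact: (phiP i).2.
rewrite inE negb_or eq_sym => /andP[t1 l1] vanish; apply: (IH l1).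
have [j tj] : exists j, t j != j.
  apply/existsP; apply: contraR t1 => /existsPn tid.
  by apply/eqP/permP => i; rewrite perm1; apply/eqP/negPn.
apply: (tensor_shift_cancel (a := F) (b := fun i => F (t i)) (j := j)) => //.
- exact: tensor_diffprod.
- by move=> c; apply: ratio => E; rewrite -E eqxx in tj.
move=> phi lin; apply/eqP; rewrite -subr_eq0 -!diffprod_shift; apply/eqP.
rewrite -[RHS](vanish phi lin); congr (diffprod _ _ _ _ - _).
by apply: funext => i; rewrite perm1.
Qed.

(** Each factor M_s - M_t turns the relation of exponent e into the difference
    of the relation of exponent e.+1 and of M_t times that of exponent e, so
    each factor uses up one exponent. *)
Lemma alternating_diffprod_eq0 N l e phi :
    (forall e h, (1 <= e <= N)%N ->
      \sum_(s : 'S_r) (-1) ^+ s * \prod_i phi i (F (s i) ^+ e * h i) = 0) ->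
    (1 <= e)%N -> (e + size l <= N)%N ->
  forall h, \sum_(s : 'S_r)
    (-1) ^+ s * diffprod l s (fun i => F (s i) ^+ e * h i) phi = 0.
Proof.
move=> alt; elim: l e => [|t l IH] e e1 /=.
  by rewrite addn0 => eN h; apply: alt; rewrite e1.
rewrite addnS -addSn => eN h.
have eN' : (e + size l <= N)%N by apply: leq_trans eN; rewrite addSn.
under eq_bigr do rewrite mulrBr.
rewrite sumrB -[RHS](subrr 0); congr (_ - _).
  rewrite -[RHS](IH e.+1 isT eN h); apply: eq_bigr => s _.
  by congr (_ * diffprod _ _ _ _); apply: funext => i; rewrite exprS mulrA.
rewrite -[RHS](IH e e1 eN' (fun i => F (t i) * h i)); apply: eq_bigr => s _.
by congr (_ * diffprod _ _ _ _); apply: funext => i; rewrite mulrCA.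
Qed.

(** The sum is the determinant of a matrix whose rows satisfy the relation c:
    functionals applied to the elements F j ^+ e * h i. *)
Lemma alternating_sum_eq0 (c : 'I_r -> k) e h phi :
    (exists i, c i != 0) -> \sum_i iota (c i) * F i ^+ e = 0 ->
    klinears iota phi ->
  \sum_(s : 'S_r) (-1) ^+ s * \prod_i phi i (F (s i) ^+ e * h i) = 0.
Proof.
move=> [i0 ci0] dep lin.
pose M := \matrix_(j, i) phi i (F j ^+ e * h i).
have detM : \det M = 0.
  apply/eqP/det0P; exists (\row_j c j).
    by apply/rV0Pn; exists i0; rewrite mxE.
  apply/rowP => i; rewrite !mxE.
  under eq_bigr do rewrite !mxE.
  rewrite -(klinear_sum _ _ (lin i)).
  under eq_bigr do rewrite mulrA.
  by rewrite -mulr_suml dep mul0r; exact: klinear0 (lin i).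
rewrite -[RHS]detM -det_tr /determinant; apply: eq_bigr => s _.
by congr (_ * _); apply: eq_bigr => i _; rewrite !mxE.
Qed.

(** The argument takes l to be the r! - 1 nontrivial permutations and starts
    from the exponent 1, so that it needs exactly the exponents from 1
    to r!. *)
Lemma powers_independent :
    (forall i, F i != 0) -> (forall i j c, i <> j -> F i / F j <> iota c) ->
  exists e : nat, (1 <= e <= r`!)%N /\
    forall c : 'I_r -> k, \sum_i iota (c i) * F i ^+ e = 0 ->
      forall i, c i = 0.
Proof.
move=> F0 ratio; apply: contrapT => none.
have dep e : (1 <= e <= r`!)%N -> exists c : 'I_r -> k,
    (exists i, c i != 0) /\ \sum_i iota (c i) * F i ^+ e = 0.
  move=> eN; apply: contrapT => nodep; apply: none; exists e; split=> // c cE i.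
  by apply: contrapT => /eqP ci; apply: nodep; exists c; split=> //; exists i.
pose l := rem (1%g : 'S_r) (enum 'S_r).
have l1 : 1%g \notin l by rewrite mem_rem_uniqF ?enum_uniq.
have sizel : (1 + size l <= r`!)%N.
  rewrite size_rem ?mem_enum // -cardE -card_Sn.
  by rewrite add1n prednK //; apply/card_gt0P; exists 1%g.
(* In the alternating sum, every s <> 1 occurs in l, so that only the term of
   s = 1 survives. *)
apply: (@diffprod1_neq0 l (fun i => F i ^+ 1 * 1)) => //.
  by move=> i; rewrite mulr1 expr1.
move=> phi lin.
have alt e h : (1 <= e <= r`!)%N ->
    \sum_(s : 'S_r) (-1) ^+ s * \prod_i phi i (F (s i) ^+ e * h i) = 0.
  move=> eN; have [c [cne cE]] := dep e eN.
  exact: alternating_sum_eq0 cne cE lin.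
have := alternating_diffprod_eq0 alt (isT : (1 <= 1)%N) sizel (fun=> 1).
rewrite (bigD1 (1%g : 'S_r)) //= odd_perm1 mul1r big1 ?addr0.
  move=> <-; congr (diffprod _ _ _ _).
  by apply: funext => i; rewrite perm1.
move=> s s1; rewrite diffprod_mem ?mulr0 // mem_rem_uniq ?enum_uniq //.
by rewrite inE s1 mem_enum.
Qed.

End Vandermonde.

Theorem theorem1 (k : closedFieldType) (R : integralAlgType k) (r : nat)
    (f : 'I_r -> R)
    (f_neq0 : forall i, f i <> 0)
    (f_ratio : forall i j, i <> j ->
       ~ in_base_field (FracField.tofrac (f i) / FracField.tofrac (f j))) :
  exists e : nat, (1 <= e <= r`!)%N /\ lin_indep (fun i => f i ^+ e).
Proof.
pose iota : {rmorphism k -> {fraction R}} := @FracField.tofrac R \o in_alg R.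
have [||e [eN indep]] :=
    @powers_independent k _ iota r (fun i => FracField.tofrac (f i)).
- by move=> i; rewrite tofrac_eq0; apply/eqP.
- by move=> i j c ij E; apply: (f_ratio i j ij); exists c.
exists e; split=> // c cE; apply: indep.
rewrite -[RHS](rmorph0 (@FracField.tofrac R)) -cE rmorph_sum.
by apply: eq_bigr => i _; rewrite -mulr_algl rmorphM rmorphXn.
Qed.
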